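(* Let $M$ be an $\omega_1$-saturated structure (with $\mathrm{Th}(M)$ countable) and let $G(M)$ be a group definable in $M$. Then $G(M)$ is weakly definably amenable: for any definable action of $G(M)$ on a compact space $X$, $X$ supports a $G(M)$-invariant, Borel probability measure.
   Context: Compact spaces are assumed Hausdorff. A function $f$ from $G(M)$ to a compact space $C$ is called definable if for every pair $C_1,C_2$ of disjoint closed subsets of $C$ there is a definable (in $M$, with parameters) set $Z\subseteq G(M)$ with $f^{-1}(C_1)\subseteq Z$ and $f^{-1}(C_2)\subseteq G(M)\setminus Z$. An action of $G(M)$ by homeomorphisms on a compact space $X$ is called definable if for every $x\in X$ the map $G(M)\to X$, $g\mapsto gx$, is definable. $G(M)$ is weakly definably amenable if every compact space on which $G(M)$ acts definably supports a $G(M)$-invariant, Borel probability measure. *)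

(* Defs.v *)
From HB Require Import structures.
From mathcomp Require Import all_boot all_order all_algebra.
From mathcomp Require Import all_classical all_reals all_analysis.

Set Implicit Arguments.
Unset Strict Implicit.
Unset Printing Implicit Defensive.

Local Open Scope classical_set_scope.

Record language := Language {
  fun_symb : Type;
  rel_symb : Type;
  fun_arity : fun_symb -> nat;
  rel_arity : rel_symb -> nat }.

Inductive term (L : language) (V : Type) : Type :=
| Var of V
| App (f : fun_symb L) of ('I_(fun_arity f) -> term L V).

(* Formulas with free variables in V; a quantifier binds the variable [None]
   of [option V].  Constant symbols are the function symbols of arity 0. *)
Inductive formula (L : language) (V : Type) : Type :=
| Falsum
| Equal of term L V & term L V
| Atom (r : rel_symb L) of ('I_(rel_arity r) -> term L V)
| Imply of formula L V & formula L V
| Forall of formula L (option V).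

Definition Neg (L : language) (V : Type) (phi : formula L V) : formula L V :=
  Imply phi (Falsum L V).

Definition sentence (L : language) : Type := formula L void.

Record structure (L : language) := Structure {
  carrier :> Type;
  carrier_nonempty : inhabited carrier;
  fun_interp : forall f : fun_symb L, ('I_(fun_arity f) -> carrier) -> carrier;
  rel_interp : forall r : rel_symb L, ('I_(rel_arity r) -> carrier) -> Prop }.

Section Semantics.
Context {L : language} {M : structure L}.

Fixpoint eval (V : Type) (v : V -> M) (t : term L V) : M :=
  match t with
  | Var x => v x
  | App f ts => @fun_interp L M f (fun i => eval v (ts i))
  end.

Definition extend (V : Type) (v : V -> M) (a : M) : option V -> M :=
  fun o => if o is Some x then v x else a.

Fixpoint sat (V : Type) (v : V -> M) (phi : formula L V) : Prop :=
  match phi with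
  | Falsum => False
  | Equal s t => eval v s = eval v t
  | Atom r ts => @rel_interp L M r (fun i => eval v (ts i))
  | Imply psi chi => sat v psi -> sat v chi
  | Forall psi => forall a : M, sat (extend v a) psi
  end.

(* A formula with free variables in V over a parameter set P is a formula
   whose variables lie in V + P, where P is interpreted by a fixed map c. *)
Definition with_params (V P : Type) (c : P -> M) (v : V -> M) : V + P -> M :=
  fun s => match s with inl x => v x | inr p => c p end.

(* Subsets of the power M^V definable with parameters from M (V finite). *)
Definition definable (V : Type) (Z : set (V -> M)) : Prop :=
  exists phi : formula L (V + M), Z = [set v | sat (with_params id v) phi].

(* The formulas of the language L_A in n free variables. *)
Definition formula_over (A : set M) (n : nat) : Type := formula L ('I_n + A).

Definition sat_over (A : set M) (n : nat) (v : 'I_n -> M)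
    (phi : formula_over A n) : Prop :=
  sat (with_params (fun a : A => \val a) v) phi.

Definition finitely_satisfiable (A : set M) (n : nat)
    (p : set (formula_over A n)) : Prop :=
  forall q : set (formula_over A n), finite_set q -> q `<=` p ->
  exists v : 'I_n -> M, forall phi, q phi -> sat_over v phi.

Definition complete_type (A : set M) (n : nat)
    (p : set (formula_over A n)) : Prop :=
  finitely_satisfiable p /\ forall phi, p phi \/ p (Neg phi).

Definition realized (A : set M) (n : nat) (p : set (formula_over A n)) : Prop :=
  exists v : 'I_n -> M, forall phi, p phi -> sat_over v phi.

End Semantics.

Definition Th (L : language) (M : structure L) : set (sentence L) :=
  [set phi | sat (M := M) (fun x : void => match x with end) phi].

(* |A| < omega_1 means that A is countable. *)
Definition omega1_saturated (L : language) (M : structure L) : Prop :=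
  forall A : set M, countable A ->
  forall (n : nat) (p : set (formula_over A n)), complete_type p -> realized p.

Record definable_group (L : language) (M : structure L) := DefinableGroup {
  dg_dim : nat;
  dg_set : set ('I_dg_dim -> M);
  dg_mul : dg_set -> dg_set -> dg_set;
  dg_one : dg_set;
  dg_inv : dg_set -> dg_set;
  dg_mulA : associative dg_mul;
  dg_mul1 : left_id dg_one dg_mul;
  dg_mulV : left_inverse dg_one dg_inv dg_mul;
  dg_set_definable : definable dg_set;
  (* the graph of the multiplication, as a subset of M^(n + n + n) *)
  dg_mul_definable : definable
    [set w : 'I_dg_dim + 'I_dg_dim + 'I_dg_dim -> M | exists x y : dg_set,
       [/\ w \o inl \o inl = \val x, w \o inl \o inr = \val y
         & w \o inr = \val (dg_mul x y)]] }.

Arguments dg_set {L M} G _ : rename.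

Definition dg_sort (L : language) (M : structure L) (G : definable_group M) :
  Type := set_type (dg_set G).
Coercion dg_sort : definable_group >-> Sortclass.

Definition definable_in (L : language) (M : structure L) (G : definable_group M)
    (Z : set G) : Prop :=
  definable [set \val g | g in Z].

Definition definable_map (L : language) (M : structure L)
    (G : definable_group M) (C : topologicalType) (f : G -> C) : Prop :=
  forall C1 C2 : set C, closed C1 -> closed C2 -> C1 `&` C2 = set0 ->
  exists Z : set G,
    [/\ definable_in Z, f @^-1` C1 `<=` Z & f @^-1` C2 `<=` ~` Z].

Definition homeomorphism (X : topologicalType) (f : X -> X) : Prop :=
  continuous f /\
  exists h : X -> X, [/\ cancel f h, cancel h f & continuous h].

Definition action_by_homeomorphisms (L : language) (M : structure L)
    (G : definable_group M) (X : topologicalType) (act : G -> X -> X) : Prop :=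
  [/\ forall x, act (dg_one G) x = x,
      forall g h x, act (dg_mul g h) x = act g (act h x)
    & forall g, homeomorphism (act g)].

Definition definable_action (L : language) (M : structure L)
    (G : definable_group M) (X : topologicalType) (act : G -> X -> X) : Prop :=
  action_by_homeomorphisms act /\
  forall x : X, definable_map (fun g => act g x).

Definition borel (X : ptopologicalType) := g_sigma_algebraType (@open X).

Definition invariant_measure (R : realType) (L : language) (M : structure L)
    (G : definable_group M) (X : ptopologicalType) (act : G -> X -> X)
    (mu : probability (borel X) R) : Prop :=
  forall (g : G) (B : set (borel X)), measurable B -> mu (act g @` B) = mu B.

(* The base point of the [ptopologicalType] X only serves to make X
   nonempty. *)
Definition weakly_definably_amenable (R : realType) (L : language)
    (M : structure L) (G : definable_group M) : Prop :=
  forall (X : ptopologicalType) (act : G -> X -> X),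
    compact [set: X] -> hausdorff_space X -> definable_action act ->
  exists mu : probability (borel X) R, invariant_measure act mu.

(* Main.v *)
(* Only one consequence of saturation is needed ([tame]): countably many definable
   conditions on g that are finitely satisfiable are satisfiable.  It yields a
   double limit property: for closed disjoint C and D there are no sequences
   g_i, x_j with g_i x_j in C for j <= i and in D for i < j.  Indeed, if y is a
   cluster point of (x_j), then g_i y is in D for all i, so by saturation some g
   keeps g y near D and all the g x_j near C, although g y is a cluster point of
   the g x_j.

   By an argument in the style of Shelah's 2-rank, the absence of such ladders
   forces fragmentation: for closed disjoint K and L there is a nonempty
   relatively open set U none of whose translates meets both K and L.  In a
   minimal subflow Y, U can be moved around any given point y0.  The least number
   of translates of U covering a set, normalised so that Y has size 1, is then
   invariant, subadditive, and additive on K and L; its ultralimit as U shrinks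
   to y0 is an invariant content, exactly as in the construction of Haar measure,
   and this content extends to a Borel probability measure by Caratheodory's
   theorem. *)
From HB Require Import structures.
Require Import Defs.
From mathcomp Require Import all_boot all_order all_algebra.
From mathcomp Require Import all_classical all_reals all_analysis.

Set Implicit Arguments.
Unset Strict Implicit.
Unset Printing Implicit Defensive.

Import Order.TTheory GRing.Theory Num.Theory.
Import numFieldNormedType.Exports.

Local Open Scope classical_set_scope.
Local Open Scope ring_scope.

(** * Separation in normal spaces and compactness *)

Lemma normal_shrink (X : topologicalType) (A W : set X) :
  normal_space X -> closed A -> open W -> A `<=` W ->
  exists U, [/\ open U, A `<=` U & closure U `<=` W].
Proof.
move=> nX cA oW AW.
have [|V /set_nbhsP[U [oU AU UV]] VW] := nX A cA W.
  by apply/set_nbhsP; exists W; split.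
by exists U; split => //; exact: subset_trans (closureS UV) VW.
Qed.

Lemma normal_separation (X : topologicalType) (A B : set X) :
  normal_space X -> closed A -> closed B -> A `&` B = set0 ->
  exists U V, [/\ open U, open V, A `<=` U, B `<=` V & U `&` V = set0].
Proof.
move=> nX cA cB /disjoints_subset AB.
have [|U [oU AU UB]] := normal_shrink nX cA _ AB; first exact: closed_openC.
exists U, (~` closure U); split => //.
- by apply: closed_openC; exact: closed_closure.
- by move=> x Bx /UB.
- by apply/disjoints_subset; rewrite setCK; exact: subset_closure.
Qed.

Lemma compact_sub_bigsetU (X : topologicalType) (K : set X) (O : (set X)^nat) :
  compact K -> (forall n, open (O n)) -> K `<=` \bigcup_n O n ->
  exists n, K `<=` \big[setU/set0]_(i < n) O i.
Proof.
move=> /compact_near_coveringP cK oO KO.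
have [|N _ /(_ N (leqnn N)) KN] :=
    cK nat \oo (fun n x => (\big[setU/set0]_(i < n) O i) x) _; last by exists N.
move=> x /KO[n _ Onx]; exists (O n, [set m | (n < m)%N]) => /=.
  by split; [exact: open_nbhs_nbhs|exact: nbhs_infty_gt].
by move=> [y m] /= [Ony nm]; rewrite -bigcup_mkord; exists n.
Qed.

(** The parts of [K] outside [U] and outside [V] are disjoint and closed. Cutting disjoint
    neighbourhoods of them out of [K] leaves the two pieces. *)
Lemma closed_setU_split (X : topologicalType) (K U V : set X) :
  normal_space X -> closed K -> open U -> open V -> K `<=` U `|` V ->
  exists K1 K2, [/\ closed K1, closed K2, K1 `<=` U, K2 `<=` V & K1 `|` K2 = K].
Proof.
move=> nX cK oU oV KUV.
have [||| U' [V' [oU' oV' KU KV UV0]]] :=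
    @normal_separation X (K `&` ~` U) (K `&` ~` V) nX.
- by apply: closedI => //; exact: open_closedC.
- by apply: closedI => //; exact: open_closedC.
- rewrite -subset0 => x [[Kx Ux] [_ Vx]].
  by case: (KUV _ Kx).
exists (K `&` ~` U'), (K `&` ~` V'); split.
- by apply: closedI => //; exact: open_closedC.
- by apply: closedI => //; exact: open_closedC.
- by move=> x [Kx U'x]; apply: contrapT => Ux; exact/U'x/KU.
- by move=> x [Kx V'x]; apply: contrapT => Vx; exact/V'x/KV.
- by rewrite -setIUr -setCI UV0 setC0 setIT.
Qed.

(** * From a content on closed sets to a Borel probability measure *)

Record content (R : realType) (X : topologicalType) (lam : set X -> R) : Prop :=
  Content {
  content0 : lam set0 = 0;
  content_mono : forall C D, closed C -> closed D -> C `<=` D -> lam C <= lam D;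
  content_subadditive : forall C D, closed C -> closed D ->
    lam (C `|` D) <= lam C + lam D;
  content_superadditive : forall C D, closed C -> closed D -> C `&` D = set0 ->
    lam C + lam D <= lam (C `|` D) }.

Section ContentMeasure.
Local Open Scope ereal_scope.
Context {R : realType} {X : ptopologicalType} (lam : set X -> R).
Hypothesis lamP : content lam.
Hypothesis cX : compact [set: X].
Hypothesis hX : hausdorff_space X.

Let nX : normal_space X.
Proof. exact: compact_normal. Qed.

(** Halmos' regularisation: a supremum over closed subsets for open sets, followed by an infimum
    over open supersets, gives an outer measure. *)
Definition inner_content (O : set X) : \bar R :=
  ereal_sup [set (lam K)%:E | K in [set K | closed K /\ K `<=` O]].

Definition outer_content (A : set X) : \bar R :=
  ereal_inf [set inner_content O | O in [set O | open O /\ A `<=` O]].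

Lemma le_inner_content O1 O2 : O1 `<=` O2 -> inner_content O1 <= inner_content O2.
Proof.
move=> O12; apply: ereal_sup_le => _ [K [cK KO] <-]; exists K => //.
by split => //; exact: subset_trans O12.
Qed.

Lemma inner_content_ub K O : closed K -> K `<=` O -> (lam K)%:E <= inner_content O.
Proof. by move=> cK KO; apply: ereal_sup_ubound; exists K. Qed.

Lemma inner_content_ge0 O : 0 <= inner_content O.
Proof.
have := inner_content_ub (@closed0 X) (@sub0set _ O).
by rewrite (content0 lamP).
Qed.

Lemma inner_contentT : inner_content setT = (lam setT)%:E.
Proof.
apply/eqP; rewrite eq_le; apply/andP; split.
  apply: ge_ereal_sup => _ [K [cK _] <-]; rewrite lee_fin.
  by apply: (content_mono lamP) => //; exact: closedT.
by apply: inner_content_ub => //; exact: closedT.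
Qed.

Lemma inner_content_fin_num O : inner_content O \is a fin_num.
Proof.
rewrite ge0_fin_numE ?inner_content_ge0//.
by apply: (le_lt_trans (le_inner_content (@subsetT _ O))); rewrite inner_contentT ltry.
Qed.

Lemma le_outer_content A B : A `<=` B -> outer_content A <= outer_content B.
Proof.
move=> AB; apply: ereal_inf_le_tmp => _ [V [oV BV] <-]; exists V => //.
by split => //; exact: subset_trans BV.
Qed.

Lemma outer_content_open O : open O -> outer_content O = inner_content O.
Proof.
move=> oO; apply/eqP; rewrite eq_le; apply/andP; split.
  by apply: ereal_inf_lbound; exists O => //; split.
by apply: le_ereal_inf_tmp => _ [U [oU OU] <-]; exact: le_inner_content.
Qed.

Lemma outer_content_ge0 A : 0 <= outer_content A.
Proof. by apply: le_ereal_inf_tmp => _ [V _ <-]; exact: inner_content_ge0. Qed.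

Lemma outer_content_fin_num A : outer_content A \is a fin_num.
Proof.
rewrite ge0_fin_numE ?outer_content_ge0//.
apply: (le_lt_trans (le_outer_content (@subsetT _ A))).
by rewrite outer_content_open ?inner_contentT ?ltry//; exact: openT.
Qed.

Lemma outer_content0 : outer_content set0 = 0.
Proof.
rewrite outer_content_open; last exact: open0.
apply/eqP; rewrite eq_le inner_content_ge0 andbT.
apply: ge_ereal_sup => _ [K [_ K0] <-].
by move: K0; rewrite subset0 => ->; rewrite (content0 lamP).
Qed.

Lemma inner_contentU U V : open U -> open V ->
  inner_content (U `|` V) <= inner_content U + inner_content V.
Proof.
move=> oU oV; apply: ge_ereal_sup => _ [K [cK KUV] <-].
have [K1 [K2 [cK1 cK2 K1U K2V <-]]] := closed_setU_split nX cK oU oV KUV.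
apply: (@le_trans _ _ ((lam K1)%:E + (lam K2)%:E)).
  by rewrite -EFinD lee_fin; exact: (content_subadditive lamP).
by apply: leeD; exact: inner_content_ub.
Qed.

(** A closed set inside the union is compact, so finitely many [O n] contain it and finite
    subadditivity applies. *)
Lemma inner_content_bigcup (O : (set X)^nat) : (forall n, open (O n)) ->
  inner_content (\bigcup_n O n) <= \sum_(n <oo) inner_content (O n).
Proof.
move=> oO; apply: ge_ereal_sup => _ [K [cK KO] <-].
have [|n Kn] := compact_sub_bigsetU _ oO KO; first exact: subclosed_compact cX _.
apply: le_trans (nneseries_lim_ge n _); last by move=> *; exact: inner_content_ge0.
rewrite big_mkord; apply: le_trans (inner_content_ub cK Kn) _.
elim: n {Kn} => [|n IHn].
  by rewrite !big_ord0 -outer_content_open ?outer_content0//; exact: open0.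
rewrite !big_ord_recr/=; apply: le_trans (inner_contentU _ (oO n)) _.
  by rewrite -bigcup_mkord; apply: bigcup_open.
exact: leeD.
Qed.

Lemma outer_content_sigma_subadditive : sigma_subadditive outer_content.
Proof.
move=> A; apply/lee_addgt0Pr => e e0.
have /choice[U_ UP] n : exists U, [/\ open U, A n `<=` U &
    inner_content U <= outer_content (A n) + (e / (2 ^ n.+1)%:R)%:E].
  have en : (0 < e / (2 ^ n.+1)%:R :> R)%R by rewrite divr_gt0// ltr0n expn_gt0.
  have [_ [U [oU AU] <-] /ltW UA] :=
    lb_ereal_inf_adherent en (outer_content_fin_num (A n)).
  by exists U.
apply: le_trans (epsilon_trick xpredT _ (ltW e0)); last first.
  by move=> n; exact: outer_content_ge0.
apply: (@le_trans _ _ (\sum_(n <oo) inner_content (U_ n))); last first.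
  apply: lee_nneseries => [n _ _|n _]; first exact: inner_content_ge0.
  by have [] := UP n.
apply: le_trans (inner_content_bigcup _); last by move=> n; have [] := UP n.
apply: ereal_inf_lbound; exists (\bigcup_n U_ n) => //; split.
  by apply: bigcup_open => n _; have [] := UP n.
by apply: subset_bigcup => n _; have [] := UP n.
Qed.

HB.instance Definition _ := isOuterMeasure.Build R X outer_content
  outer_content0 outer_content_ge0 le_outer_content
  outer_content_sigma_subadditive.

(** For an open [V] around the test set, take [K] closed in [V] and [U], then [L] closed in [V]
    minus [K]. They are disjoint, so superadditivity bounds their sum by the content of [V].
    Finiteness of all values allows moving terms across the inequalities. *)
Lemma open_caratheodory U : open U -> outer_content.-caratheodory U.
Proof.
move=> oU; apply: le_caratheodory_measurable => A.
apply: le_ereal_inf_tmp => _ [V [oV AV] <-].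
apply: (@le_trans _ _ (inner_content (V `&` U) + outer_content (V `&` ~` U))).
  rewrite -outer_content_open; last exact: openI.
  by apply: leeD; apply: le_outer_content; exact: setSI.
rewrite -leeBrDr ?outer_content_fin_num//.
apply: ge_ereal_sup => _ [K [cK KVU] <-].
rewrite leeBrDr ?outer_content_fin_num// addeC.
rewrite -leeBrDr//; apply: (@le_trans _ _ (inner_content (V `&` ~` K))).
  apply: ereal_inf_lbound; exists (V `&` ~` K) => //; split.
    by apply: openI => //; exact: closed_openC.
  by move=> x [Vx Ux]; split => // /KVU[].
apply: ge_ereal_sup => _ [L [cL LVK] <-].
rewrite leeBrDr// -EFinD.
apply: (@le_trans _ _ (lam (L `|` K))%:E).
  rewrite lee_fin; apply: (content_superadditive lamP) => //.
  by apply/disjoints_subset => x /LVK[].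
apply: inner_content_ub; first exact: closedU.
by rewrite subUset; split => [x /LVK[]|x /KVU[]].
Qed.

Lemma borel_caratheodory : @measurable _ (borel X) `<=` outer_content.-caratheodory.
Proof.
apply: smallest_sub => [|U]; last exact: open_caratheodory.
split => [|A mA|F mF].
- exact: caratheodory_measurable_set0.
- by rewrite setTD; exact: caratheodory_measurable_setC.
- exact: caratheodory_measurable_bigcup.
Qed.

(** The same function retyped over [borel X], which is where the measure structure is attached. *)
Definition content_measure : set (borel X) -> \bar R := outer_content.

Let content_measure0 : content_measure set0 = 0.
Proof. exact: outer_content0. Qed.

Let content_measure_ge0 A : 0 <= content_measure A.
Proof. exact: outer_content_ge0. Qed.

Let content_measure_sigma_additive : semi_sigma_additive content_measure.
Proof.
move=> F mF tF mUF.
by apply: (@caratheodory_measure_sigma_additive _ _ outer_content) => //;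
  [move=> n|]; exact: borel_caratheodory.
Qed.

HB.instance Definition _ := isMeasure.Build _ (borel X) R content_measure
  content_measure0 content_measure_ge0 content_measure_sigma_additive.

Hypothesis lamT : lam setT = 1%R.

Let content_measureT : content_measure setT = 1.
Proof.
rewrite /content_measure outer_content_open; last exact: openT.
by rewrite inner_contentT lamT.
Qed.

HB.instance Definition _ := Measure_isProbability.Build _ (borel X) R content_measure
  content_measureT.

Definition content_probability : probability (borel X) R := content_measure.

(** A homeomorphism permutes the closed sets and the open sets, so invariance passes from [lam]
    through the supremum and then the infimum. *)
Lemma content_probability_invariant (h k : X -> X) :
  continuous h -> continuous k -> cancel h k -> cancel k h ->
  (forall C, closed C -> lam (h @` C) = lam C) ->
  forall B, content_probability (h @` B) = content_probability B.
Proof.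
move=> ch ck hk kh lamh.
have hE A : h @` A = k @^-1` A.
  apply/seteqP; split => [_ [y Ay <-]|x Akx] /=; first by rewrite hk.
  by exists (k x).
have inner_h O : inner_content (h @` O) = inner_content O.
  apply/eqP; rewrite eq_le; apply/andP; split.
    apply: ge_ereal_sup => _ [K [cK KO] <-].
    have cK' : closed (h @^-1` K) by apply: closed_comp.
    rewrite -(_ : h @` (h @^-1` K) = K) ?lamh//; last first.
      by rewrite hE; apply/seteqP; split => x /=; rewrite kh.
    by apply: inner_content_ub => // x /KO[y Oy /(can_inj hk) <-].
  apply: ge_ereal_sup => _ [K [cK KO] <-]; rewrite -(lamh _ cK).
  apply: inner_content_ub; last exact: image_subset.
  by rewrite hE; apply: closed_comp.
move=> B; apply/eqP; rewrite eq_le; apply/andP; split.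
  apply: le_ereal_inf_tmp => _ [V [oV BV] <-]; rewrite -inner_h.
  apply: ereal_inf_lbound; exists (h @` V) => //; split.
    by rewrite hE; apply: open_comp.
  exact: image_subset.
apply: le_ereal_inf_tmp => _ [V [oV BV] <-].
apply: ereal_inf_lbound; exists (h @^-1` V).
  split; first by apply: open_comp.
  by move=> x Bx; apply: BV; exists x.
rewrite -inner_h; congr inner_content.
by rewrite hE; apply/seteqP; split => x /=; rewrite kh.
Qed.

End ContentMeasure.

(** * Renaming of variables and free variables of formulas *)

Section Syntax.
Context {L : language}.

Fixpoint map_term (V W : Type) (f : V -> W) (t : term L V) : term L W :=
  match t with
  | Var x => Var L (f x)
  | App g ts => @App L W g (fun i => map_term f (ts i))
  end.

Fixpoint map_formula (V W : Type) (f : V -> W) (phi : formula L V) :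
    formula L W :=
  match phi with
  | Falsum => Falsum L W
  | Equal s t => Equal (map_term f s) (map_term f t)
  | Atom r ts => @Atom L W r (fun i => map_term f (ts i))
  | Imply psi chi => Imply (map_formula f psi) (map_formula f chi)
  | Forall psi => Forall (map_formula (omap f) psi)
  end.

Fixpoint term_vars (V : Type) (t : term L V) : set V :=
  match t with
  | Var x => [set x]
  | App g ts => \bigcup_i term_vars (ts i)
  end.

Fixpoint free_vars (V : Type) (phi : formula L V) : set V :=
  match phi with
  | Falsum => set0
  | Equal s t => term_vars s `|` term_vars t
  | Atom r ts => \bigcup_i term_vars (ts i)
  | Imply psi chi => free_vars psi `|` free_vars chi
  | Forall psi => Some @^-1` free_vars psi
  end.

Lemma countable_setU2 T (A B : set T) :
  countable A -> countable B -> countable (A `|` B).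
Proof.
by move=> cA cB; rewrite -bigcup2E; apply: bigcup_countable => // -[|[|i]] _ //=.
Qed.

Lemma countable_preimage T U (f : T -> U) (A : set U) :
  injective f -> countable A -> countable (f @^-1` A).
Proof.
move=> finj /countable_injP[g ginj]; apply/countable_injP; exists (g \o f).
by move=> x y /[!inE] Ax Ay /ginj /[!inE] /(_ Ax Ay) /finj.
Qed.

Lemma countable_term_vars V (t : term L V) : countable (term_vars t).
Proof.
elim: t => [x|g ts IH] /=; first exact: countable1.
by apply: bigcup_countable => // i _; exact: IH.
Qed.

(** Ensures that countably many formulas involve only countably many parameters, as saturation
    requires. *)
Lemma countable_free_vars V (phi : formula L V) : countable (free_vars phi).
Proof.
elim: phi => {V} [V|V s t|V r ts|V psi IH1 chi IH2|V psi IH] /=.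
- exact: countable0.
- by apply: countable_setU2; exact: countable_term_vars.
- by apply: bigcup_countable => // i _; exact: countable_term_vars.
- exact: countable_setU2.
- by apply: countable_preimage IH => x y [].
Qed.

Context {M : structure L}.

Lemma eval_map_term V W (f : V -> W) (v : W -> M) (t : term L V) :
  Defs.eval v (map_term f t) = Defs.eval (v \o f) t.
Proof.
elim: t => [x|g ts IH] //=.
by congr fun_interp; apply/funext => i; exact: IH.
Qed.

Lemma sat_map_formula V W (f : V -> W) (v : W -> M) (phi : formula L V) :
  sat v (map_formula f phi) <-> sat (v \o f) phi.
Proof.
elim: phi W f v => {V} [V|V s t|V r ts|V psi IH1 chi IH2|V psi IH] W f v //=.
- by rewrite !eval_map_term.
- by under eq_fun do rewrite eval_map_term.
- by split=> H /IH1/H/IH2.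
- have E a : extend v a \o omap f = extend (v \o f) a by apply/funext => -[].
  by split=> H a; [rewrite -E; exact/IH|apply/IH; rewrite E].
Qed.

Lemma eq_eval V (v w : V -> M) (t : term L V) :
  (forall x, term_vars t x -> v x = w x) -> Defs.eval v t = Defs.eval w t.
Proof.
elim: t => [x|g ts IH] /= vw; first exact: vw.
congr fun_interp; apply/funext => i; apply: IH => x tx.
by apply: vw; exists i.
Qed.

Lemma eq_sat V (v w : V -> M) (phi : formula L V) :
  (forall x, free_vars phi x -> v x = w x) -> sat v phi <-> sat w phi.
Proof.
elim: phi v w => {V} [V|V s t|V r ts|V psi IH1 chi IH2|V psi IH] v w //= vw.
- by rewrite (@eq_eval _ v w s) ?(@eq_eval _ v w t)// => x xP; apply: vw; [right|left].
- suff -> : (fun i => Defs.eval v (ts i)) = (fun i => Defs.eval w (ts i)) by [].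
  by apply/funext => i; apply: eq_eval => x tx; apply: vw; exists i.
- have H1 := IH1 v w (fun x xP => vw x (or_introl xP)).
  have H2 := IH2 v w (fun x xP => vw x (or_intror xP)).
  by split=> H /H1/H/H2.
- by split=> H a; apply/(IH (extend v a) (extend w a)); rewrite // => -[x xP|//]; exact: vw.
Qed.

End Syntax.

(** * Ultrafilters and countable saturation *)

Lemma finite_bigcap_filter (T I : Type) (F : set_system T) {FF : Filter F} (q : set I)
    (S : I -> set T) : finite_set q ->
  (forall i, q i -> F (S i)) -> F (\bigcap_(i in q) S i).
Proof.
move=> /finite_setP[n]; elim: n q => [|n IHn] q.
  by rewrite II0 card_eq0 => /eqP -> _; rewrite bigcap_set0; exact: filterT.
move=> /eq_cardSP[x qx /IHn{}IHn] qS.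
rewrite -(setD1K qx) bigcap_setU1; apply: filterI; first exact: qS.
by apply: IHn => i [qi _]; exact: qS.
Qed.

(** Saturation speaks of complete types over a countable set. The parameters of all the formulas
    form such a set, and an ultrafilter containing the finite conjunctions completes the partial
    type. *)
Lemma definable_countably_compact (L : language) (M : structure L) (n : nat)
    (Z : nat -> set ('I_n -> M)) :
  omega1_saturated M -> (forall k, definable (Z k)) ->
  (forall k, exists v, forall i, (i < k)%N -> Z i v) ->
  exists v, forall k, Z k v.
Proof.
move=> satM /choice[phi ZE] finZ.
have [m0] := carrier_nonempty M.
(* The point [m0] makes [A] nonempty, so that the retraction [r] of [M] onto [A] exists even when no
   parameter occurs. *)
pose A : set M := [set m0] `|` \bigcup_k (inr @^-1` free_vars (phi k)).
have cA : countable A.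
  apply: countable_setU2; first exact: countable1.
  apply: bigcup_countable => // k _; apply: countable_preimage => [x y []//|].
  exact: countable_free_vars.
have Am0 : A m0 by left.
pose r (m : M) : A := insubd (SigSub (mem_set Am0) : A) m.
have rE m : A m -> \val (r m) = m by move=> Am; rewrite val_insubd mem_set.
pose psi k : formula_over A n :=
  map_formula (fun s => match s with inl i => inl i | inr m => inr (r m) end)
    (phi k).
have psiE k v : sat_over v (psi k) <-> Z k v.
  rewrite ZE /sat_over sat_map_formula; apply: eq_sat => -[//|m] phim /=.
  by apply: rE; right; exists k.
pose F : set_system ('I_n -> M) :=
  filter_from setT (fun k => [set v | forall i, (i < k)%N -> Z i v]).
have FF : ProperFilter F.
  apply: filter_from_proper => [|k _]; last exact: finZ.
  apply: filter_from_filter => [|i j _ _]; first by exists 0%N.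
  exists (maxn i j) => // v vP.
  by split=> k ki; apply: vP; rewrite leq_max ki ?orbT.
have [U [UU FU]] := ultraFilterLemma FF.
(* The type consists of the formulas that hold at [U]-almost every tuple. *)
have [|v vP] := satM A cA n [set chi | U [set v | sat_over v chi]].
  split=> [q fq qp|chi]; last exact: in_ultra_setVsetC.
  have /filter_ex[v vP] : U (\bigcap_(chi in q) [set v | sat_over v chi]).
    exact: finite_bigcap_filter.
  by exists v.
(* The basic set of index [k] imposes only the conditions below [k], hence the successor. *)
exists v => k; apply/psiE/vP; apply: FU; exists k.+1 => // w wP /=.
by apply/psiE; exact: wP.
Qed.

(* Each condition on [g] only concerns the orbit map of a single point [x n], so
   definability of these maps suffices and the group law is not involved. *)
Lemma tame_definable_action (L : language) (M : structure L)
    (G : definable_group M) (X : topologicalType) (act : G -> X -> X)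
    (x : nat -> X) (C D : nat -> set X) :
  omega1_saturated M -> definable_action act ->
  (forall n, closed (C n)) -> (forall n, closed (D n)) ->
  (forall n, C n `&` D n = set0) ->
  (forall n, exists g, forall i, (i < n)%N -> C i (act g (x i))) ->
  exists g, forall n, ~ D n (act g (x n)).
Proof.
move=> satM [_ defA] cC cD CD0 fipC.
have /choice[Z ZP] n := defA (x n) (C n) (D n) (cC n) (cD n) (CD0 n).
have [|n|v vP] := @definable_countably_compact _ _ _ (fun n => [set \val g | g in Z n]) satM.
- by move=> k; have [] := ZP k.
- have [g gC] := fipC n; exists (\val g) => i /gC; have [_ CZ _] := ZP i.
  by move=> /CZ Zg; exists g.
(* Condition 0 already shows that the tuple [v] is an element of the group. *)
have [g _ gv] := vP 0%N.
exists g => n; have [h Zh hv] := vP n; have [_ _ DZ] := ZP n.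
have -> : g = h by apply: val_inj; rewrite gv hv.
by move=> /DZ.
Qed.

(** A compact interval provides a cluster point, and a cluster point of an ultrafilter is a
    limit. *)
Lemma ultra_cvg_bounded (R : realType) (I : Type) (F : set_system I)
    (f : I -> R) (a b : R) : UltraFilter F ->
  (\forall i \near F, a <= f i <= b) -> exists l : R, f @ F --> l.
Proof.
move=> UF abf.
have FF : ProperFilter (f @ F) by exact: fmap_proper_filter.
have [l [_ cll]] := @segment_compact R a b (f @ F) FF abf.
exists l => B lB; have [//|FB] := in_ultra_setVsetC (f @^-1` B) UF.
by have [x []] := cll (~` B) B FB lB.
Qed.

Record split_state (G X : Type) := SplitState {
  state_nbhs : set X; state_elts : set G;
  state_side : bool; state_point : X; state_elt : G }.

(** * Ladders and fragmentation in tame flows *)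

Section TameFlow.
Context {X : ptopologicalType} {G : Type}.
Context (one : G) (mul : G -> G -> G) (inv : G -> G) (act : G -> X -> X).
Hypothesis cX : compact [set: X].
Hypothesis hX : hausdorff_space X.
Hypothesis act1 : forall x, act one x = x.
Hypothesis actM : forall g h x, act (mul g h) x = act g (act h x).
Hypothesis actK : forall g, cancel (act g) (act (inv g)).
Hypothesis actVK : forall g, cancel (act (inv g)) (act g).
Hypothesis act_cont : forall g, continuous (act g).
Hypothesis tame : forall (x : nat -> X) (C D : nat -> set X),
  (forall n, closed (C n)) -> (forall n, closed (D n)) ->
  (forall n, C n `&` D n = set0) ->
  (forall n, exists g, forall i, (i < n)%N -> C i (act g (x i))) ->
  exists g, forall n, ~ D n (act g (x n)).

Let nX : normal_space X.
Proof. exact: compact_normal. Qed.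

(** The infinite index set [I] lets a ladder be extracted from a sequence by the pigeonhole
    principle. *)
Lemma no_ladder (C D : set X) (I : set nat) (g : nat -> G) (x : nat -> X) :
  closed C -> closed D -> C `&` D = set0 ->
  (forall n, exists2 m, (n <= m)%N & I m) ->
  (forall i j, I i -> I j -> (j <= i)%N -> C (act (g i) (x j))) ->
  (forall i j, I i -> I j -> (i < j)%N -> D (act (g i) (x j))) ->
  False.
Proof.
move=> cC cD CD0 Iinf ladC ladD.
have [U [V [oU oV CU DV UV0]]] := normal_separation nX cC cD CD0.
pose F := filter_from setT (fun n => [set x j | j in [set j | I j /\ (n <= j)%N]]).
have FF : ProperFilter F.
  apply: filter_from_proper => [|n _]; last first.
    by have [m nm Im] := Iinf n; exists (x m), m.
  apply: filter_from_filter => [|i j _ _]; first by exists 0%N.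
  exists (maxn i j) => // _ [k [Ik /[!geq_max] /andP[ik jk]] <-].
  by split; exists k.
have [y [_ clFy]] := cX FF filterT.
have yD i : I i -> D (act (g i) y).
  move=> Ii; apply: cD => B /act_cont gB.
  have [_ [[j [Ij ij] <-] Bj]] :=
    clFy _ _ (ex_intro2 _ _ i.+1 Logic.I (fun _ h => h)) gB.
  by exists (act (g i) (x j)); split => //; exact: ladD.
(* Index 0 holds the cluster point [y], index n + 1 the point [x n]. *)
pose x' n := if n is m.+1 then x m else y.
(* [tame] only yields an element avoiding the sets [D']. As complements of neighbourhoods they force
   its values into [U] and [V]; indices outside [I] impose nothing. *)
pose C' n := if n is m.+1 then if `[<I m>] then C else setT else D.
pose D' n := if n is m.+1 then if `[<I m>] then ~` U else set0 else ~` V.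
have [||||h hD] := @tame x' C' D'.
- by case=> [|n] //=; case: ifP => // _; exact: closedT.
- case=> [|n] /=; first exact: open_closedC.
  by case: ifP => // _; [exact: open_closedC|exact: closed0].
- case=> [|n] /=; first by apply/disjoints_subset; rewrite setCK.
  case: ifP => _; last by rewrite setI0.
  by apply/disjoints_subset; rewrite setCK.
- move=> n; have [m nm Im] := Iinf n; exists (g m) => -[_|i] /=; first exact: yD.
  case: ifPn => // /asboolP Ii im; apply: ladC => //.
  by apply: leq_trans nm; do 2 apply: ltnW.
have Vhy : V (act h y) by apply: contrapT; exact: hD 0%N.
have gV : nbhs y (act h @^-1` V) by apply: act_cont; exact: open_nbhs_nbhs.
have [_ [[j [Ij _] <-] Vj]] :=
  clFy _ _ (ex_intro2 _ _ 0%N Logic.I (fun _ h => h)) gV.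
have := hD j.+1; rewrite /= asboolT//= => /contrapT Uj.
by move: UV0; rewrite -subset0 => /(_ (act h (x j))); exact.
Qed.

Definition splits (Y U K L : set X) (g : G) : Prop :=
  (exists u, [/\ U u, Y u & K (act g u)]) /\
  (exists v, [/\ U v, Y v & L (act g v)]).

(** Otherwise every nonempty relatively open set is split by some element. Each round picks a point
    of the current open set, keeps only elements sending it to one side, and shrinks the open set so
    that one kept element sends it to the opposite side. Rounds with equal side form a ladder. *)
Lemma fragmentation (Y K L : set X) : Y !=set0 ->
  closed K -> closed L -> K `&` L = set0 ->
  exists U, [/\ open U, U `&` Y !=set0 & forall g, ~ splits Y U K L g].
Proof.
move=> [y0 Yy0] cK cL KL0; apply: contrapT => noU.
have spl U : open U -> U `&` Y !=set0 -> exists g, splits Y U K L g.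
  move=> oU UY; apply: contrapT => nospl; apply: noU; exists U; split => // g sg.
  by apply: nospl; exists g.
have [K2 [L2 [oK2 oL2 KK2 LL2 KL20]]] := normal_separation nX cK cL KL0.
have [K1 [oK1 KK1 K12]] := normal_shrink nX cK oK2 KK2.
have [L1 [oL1 LL1 L12]] := normal_shrink nX cL oL2 LL2.
(* The shrinkings [K1] and [L1] keep the closure of [E b] disjoint from the closed set [C b]. *)
pose C b := if b then ~` K2 else ~` L2.
pose E b := if b then K1 else L1.
pose S := split_state G X.
(* Splitting is demanded for all open subsets that meet [Y], so it survives shrinking the open set.
   The side, point and element of a state record the latest choice. *)
pose good (s : S) := [/\ open (state_nbhs s), state_nbhs s `&` Y !=set0 &
  forall U, open U -> U `<=` state_nbhs s -> U `&` Y !=set0 ->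
    exists2 g, state_elts s g & splits Y U K L g].
pose step (s t : S) := [/\ state_nbhs t `<=` state_nbhs s,
  state_elts t `<=` state_elts s, state_nbhs s (state_point t),
  state_elts t (state_elt t) &
  (forall a, state_elts t a -> C (state_side t) (act a (state_point t))) /\
  (forall u, state_nbhs t u -> E (state_side t) (act (state_elt t) u))].
have next (s : {s | good s}) : {t : {t | good t} | step (sval s) (sval t)}.
  apply: cid; case: s => -[U A b0 x g] /= [/= oU [u [Uu Yu]] largeA].
  (* [C true] and [C false] cover [X], so one of the two halves [Ab b] of [A]
     still splits every open subset of some [V]. *)
  pose Ab b := A `&` [set a | C b (act a u)].
  have [b [V [oV VU VY largeV]]] : exists b V, [/\ open V, V `<=` U, V `&` Y !=set0
      & forall U', open U' -> U' `<=` V -> U' `&` Y !=set0 ->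
        exists2 g, Ab b g & splits Y U' K L g].
    apply: contrapT => nolarge.
    have [W [oW WU WY WA]] : exists W, [/\ open W, W `<=` U, W `&` Y !=set0 &
        forall g, Ab true g -> ~ splits Y W K L g].
      apply: contrapT => noW; apply: nolarge; exists true, U.
      split=> //; first by exists u.
      move=> U' oU' U'U U'Y; apply: contrapT => nog; apply: noW.
      by exists U'; split => // h Ah sh; apply: nog; exists h.
    apply: nolarge; exists false, W; split=> // U' oU' U'W U'Y.
    have [h Ah sh] := largeA _ oU' (subset_trans U'W WU) U'Y; exists h => //.
    split=> //= Lh; apply: (WA h); last first.
      by case: sh => [[v [/U'W ? ? ?]] [w [/U'W ? ? ?]]]; split; [exists v|exists w].
    split=> //= Kh.
    by move: KL20; rewrite -subset0 => /(_ (act h u)); exact.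
  have [h Abh sh] := largeV V oV (@subset_refl _ V) VY.
  have ctsE : open (act h @^-1` E b).
    by apply: open_comp => [z _|]; [exact: act_cont|rewrite /E; case: (b)].
  (* As [h] splits [V], it sends points of [V] into both [K] and [L], so either value of [b] is
     served. *)
  have [w [Vw Yw Ew]] : exists w, [/\ V w, Y w & E b (act h w)].
    rewrite /E; case: sh => [[v [? ? /KK1 ?]] [w [? ? /LL1 ?]]].
    by case: (b); [exists v|exists w].
  unshelve eexists.
    exists (SplitState (V `&` act h @^-1` E b) (Ab b) b u h).
    split=> /=; [exact: openI| by exists w|].
    by move=> U' oU' U'V; apply: largeV => // z /U'V[].
  by split => //=; [by move=> z [/VU]|by move=> z []|split => [a [_]//|z []]].
(* The last three fields are placeholders: they are read only from [s n.+1]. *)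
have s0P : good (SplitState setT setT true y0 one).
  split; [exact: openT|by exists y0|] => U oU _ /(spl _ oU)[g sg].
  by exists g.
have [f [_ fS]] := dependent_choice next (exist _ _ s0P).
pose s n := sval (f n).
have nbhs_dec i j : (i <= j)%N -> state_nbhs (s j) `<=` state_nbhs (s i).
  move=> /subnK <-; elim: (j - i)%N => //= k IH.
  by apply: subset_trans IH; rewrite addSn; have [] := fS (k + i)%N.
have elts_dec i j : (i <= j)%N -> state_elts (s j) `<=` state_elts (s i).
  move=> /subnK <-; elim: (j - i)%N => //= k IH.
  by apply: subset_trans IH; rewrite addSn; have [] := fS (k + i)%N.
pose side n := state_side (s n.+1).
have [b binf] : exists b, forall n, exists2 m, (n <= m)%N & side m = b.
  have [?|/existsNP[n nom]] := pselect (forall n, exists2 m, (n <= m)%N & side m = false).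
    by exists false.
  exists true => k.
  exists (maxn n k); first exact: leq_maxr.
  apply: contrapT => /negP/negbTE sf; apply: nom; exists (maxn n k) => //.
  exact: leq_maxl.
apply: (@no_ladder (C b) (closure (E b)) [set n | side n = b]
  (fun n => state_elt (s n.+1)) (fun n => state_point (s n.+1))) => //.
- by rewrite /C; case: (b); exact: open_closedC.
- exact: closed_closure.
- rewrite setIC; apply/disjoints_subset.
  by rewrite /C /E; case: (b); rewrite setCK.
- move=> i j ib jb ij /=; rewrite -[in C b]jb.
  have [_ _ _ _ [Cj _]] := fS j; apply: Cj.
  by apply: (elts_dec j.+1 i.+1 ij); have [_ _ _ + _] := fS i.
- move=> i j ib jb ij /=; apply: subset_closure; rewrite -[in E b]ib.
  have [_ _ _ _ [_ Ei]] := fS i; apply: Ei.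
  by apply: (nbhs_dec i.+1 j ij); have [_ _ + _ _] := fS j.
Qed.

(** * Minimal subflows, with minimality stated as density of orbits *)

Definition minimal_set (Y : set X) : Prop :=
  [/\ closed Y, Y !=set0, forall g y, Y y -> Y (act g y) &
      forall y U, Y y -> open U -> U `&` Y !=set0 -> exists g, U (act g y)].

(** Zorn's lemma is applied to the complements, the proper open invariant sets. By compactness the
    union of a chain stays proper. *)
Lemma minimal_set_exists : exists Y, minimal_set Y.
Proof.
pose P (V : set X) := [/\ open V, ~` V !=set0 & forall g y, V (act g y) -> V y].
have [|V [[oV [y0 Vy0] invV] maxV]] := @Zorn_bigcup X P.
  move=> S SP totS; split.
  - by apply: bigcup_open => V /SP[].
  - have [[V0 SV0]|S0] := pselect (S !=set0); last first.
      by exists point => -[V SV _]; apply: S0; exists V.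
    pose F := filter_from S (fun V => ~` V).
    have FF : ProperFilter F.
      apply: filter_from_proper => [|V /SP[]//].
      apply: filter_from_filter => [|V W SV SW]; first by exists V0.
      have [VW|WV] := totS V W SV SW.
        by exists W => // x Wx; split => // Vx; exact/Wx/VW.
      by exists V => // x Vx; split => // Wx; exact/Vx/WV.
    have [y [_ clFy]] := cX FF filterT.
    exists y => -[V SV Vy].
    have [oV _ _] := SP _ SV.
    have FV : F (~` V) by exists V.
    by have [x []] := clFy _ _ FV (open_nbhs_nbhs (conj oV Vy)).
  - by move=> g y [V SV Vy]; exists V => //; have [_ _ VP] := SP _ SV; exact: VP Vy.
exists (~` V); split.
- exact: open_closedC.
- by exists y0.
- by move=> g y Vy /invV.
- move=> y U Vy oU [z [Uz Vz]]; apply: contrapT => noU.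
  (* Adding to [V] the points whose orbit meets [U] gives a strictly larger invariant open set,
     still missing [y]. *)
  apply: (maxV (V `|` \bigcup_g (act g @^-1` U))).
    split; first exact: subsetUl.
    by move=> /(_ z) VU; apply/Vz/VU; right; exists one => //=; rewrite act1.
  split.
  + apply: openU => //; apply: bigcup_open => g _.
    by apply: open_comp => // x _; exact: act_cont.
  + by exists y => -[//|[g _ Ug]]; apply: noU; exists g.
  + move=> g x [/invV|[h _ /= Uh]]; first by left.
    by right; exists (mul h g) => //=; rewrite actM.
Qed.

(** Some [h] moves [y0] into the set given by [fragmentation]. If [g] split the preimage of that set
    under [h], then [g] times the inverse of [h] would split the set itself. *)
Lemma minimal_nonsplit (Y K L : set X) (y0 : X) : minimal_set Y -> Y y0 ->
  closed K -> closed L -> K `&` L = set0 ->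
  exists U, [/\ open U, U y0 & forall g, ~ splits Y U K L g].
Proof.
move=> [_ _ invY minY] Yy0 cK cL KL0.
have [|U [oU UY nospl]] := @fragmentation Y K L _ cK cL KL0; first by exists y0.
have [h Uh] := minY _ _ Yy0 oU UY.
exists (act h @^-1` U); split=> //.
  by apply: open_comp => // x _; exact: act_cont.
move=> g [[u [Uu Yu Ku]] [v [Uv Yv Lv]]].
apply: (nospl (mul g (inv h))); split.
  by exists (act h u); rewrite actM actK; split => //; exact: invY.
by exists (act h v); rewrite actM actK; split => //; exact: invY.
Qed.

(** * Haar covering numbers and the invariant content *)

Definition covers (Y U C : set X) (s : seq G) : Prop :=
  forall y, Y y -> C y -> has (fun g => `[< U (act g y) >]) s.

Lemma minimal_covers (Y U C : set X) : minimal_set Y -> open U ->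
  U `&` Y !=set0 -> exists s, covers Y U C s.
Proof.
move=> [cY _ _ minY] oU UY.
have : compact Y by exact: subclosed_compact cX _.
rewrite compact_cover => /(_ {classic G} setT (fun g => act g @^-1` U)).
case=> [g _|y Yy|D _ YD].
- by apply: open_comp => // x _; exact: act_cont.
- by have [g Ug] := minY _ _ Yy oU UY; exists g.
exists (finmap.enum_fset D) => y /YD[g gD Ug] _.
apply/(@hasP {classic G}); exists g => //; exact/asboolP.
Qed.

(** [N C] is the least length of a sequence covering the part of [C] in [Y]. Multiplying a cover on
    the right by the inverse of [g] covers the translate by [g], whence invariance. *)
Lemma covering_number (Y U : set X) : minimal_set Y -> open U -> U `&` Y !=set0 ->
  exists N : set X -> nat,
  [/\ N set0 = 0%N /\ (0 < N setT)%N,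
      forall C D, C `<=` D -> (N C <= N D)%N,
      forall C D, (N (C `|` D) <= N C + N D)%N,
      forall C D, (forall g, ~ splits Y U C D g) ->
        (N C + N D <= N (C `|` D))%N &
      forall g C, N (act g @` C) = N C].
Proof.
move=> minY oU UY; have [cY [y0 Yy0] invY _] := minY.
have /choice[N NP] C : exists n, (exists2 s, covers Y U C s & size s = n) /\
    forall s, covers Y U C s -> (n <= size s)%N.
  have exn : exists n, `[< exists2 s, covers Y U C s & size s = n >].
    have [s sC] := @minimal_covers Y U C minY oU UY.
    by exists (size s); apply/asboolP; exists s.
  case: (ex_minnP exn) => n /asboolP sn minn; exists n; split => // s sC.
  by apply: minn; apply/asboolP; exists s.
have NE C : exists2 s, covers Y U C s & size s = N C by have [] := NP C.
have Nmin C s : covers Y U C s -> (N C <= size s)%N by have [_] := NP C; exact.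
have leN g C : (N (act g @` C) <= N C)%N.
  have [s sC <-] := NE C; rewrite -(size_map (fun h => mul h (inv g)) s).
  apply: Nmin => z Yz [y Cy yz]; rewrite has_map.
  have Yy : Y y by rewrite -(actK g y) yz; exact: invY.
  have := sC y Yy Cy.
  apply: sub_has => h /asboolP Uh; apply/asboolP => /=.
  by rewrite -yz actM actK.
exists N; split.
- split; first by apply/eqP; rewrite -leqn0; exact: (Nmin set0 [::]).
  have [s sT <-] := NE setT.
  by case: s sT => // /(_ _ Yy0 Logic.I).
- move=> C D CD; have [s sD <-] := NE D; apply: Nmin => y Yy /CD; exact: sD.
- move=> C D; have [s sC <-] := NE C; have [t tD <-] := NE D.
  rewrite -size_cat; apply: Nmin => y Yy CDy; rewrite has_cat.
  by case: CDy => [/(sC y Yy)->//|/(tD y Yy)->]; rewrite orbT.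
- move=> C D nospl; have [s sCD <-] := NE (C `|` D).
  (* No [g] hits both [C] and [D], as its inverse would split them. *)
  pose hits E g := `[< exists y, [/\ Y y, E y & U (act g y)] >].
  (* The members of [s] that hit [E] already cover [E]. *)
  have hitN E : E `<=` C `|` D -> (N E <= count (hits E) s)%N.
    move=> ECD; rewrite -size_filter; apply: Nmin => y Yy Ey.
    rewrite has_count count_filter -has_count.
    have := sCD y Yy (ECD _ Ey); apply: sub_has => g Ug /=.
    rewrite Ug; apply/asboolP; exists y; split => //; exact/asboolP.
  apply: leq_trans (leq_add (hitN C _) (hitN D _)) _.
  + exact: subsetUl.
  + exact: subsetUr.
  rewrite -count_predUI [X in (_ + X)%N](_ : _ = 0%N) ?addn0 ?count_size//.
  apply/eqP; rewrite -leqn0 leqNgt -has_count; apply/negP.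
  suff /eq_has -> : predI (hits C) (hits D) =1 pred0 by rewrite has_pred0.
  move=> g; apply/negbTE/negP => /andP[/asboolP[y [Yy Cy Uy]] /asboolP[z [Yz Dz Uz]]].
  apply: (nospl (inv g)); split.
    by exists (act g y); rewrite actK; split => //; exact: invY.
  by exists (act g z); rewrite actK; split => //; exact: invY.
- move=> g C; apply/eqP; rewrite eqn_leq leN /=.
  have := leN (inv g) (act g @` C).
  rewrite (_ : act (inv g) @` (act g @` C) = C)//.
  apply/seteqP; split => [_ [_ [y Cy <-] <-]|y Cy]; first by rewrite actK.
  by exists (act g y); rewrite ?actK//; exists y.
Qed.

(** All properties except superadditivity hold for each [U] and pass to the ultralimit.
    Superadditivity for given disjoint [C] and [D] holds once [U] is small enough. *)
Lemma invariant_content (R : realType) : exists lam : set X -> R,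
  [/\ content lam, lam setT = 1 & forall g C, lam (act g @` C) = lam C].
Proof.
have [Y minY] := minimal_set_exists; have [cY [y0 Yy0] invY _] := minY.
have /choice[f fP] (U : set X) : exists l : set X -> R, open U -> U y0 ->
    [/\ l set0 = 0 /\ l setT = 1,
        forall C D, C `<=` D -> l C <= l D,
        forall C D, l (C `|` D) <= l C + l D,
        forall C D, (forall g, ~ splits Y U C D g) -> l C + l D <= l (C `|` D) &
        forall g C, l (act g @` C) = l C].
  (* The zero function is a default where [U] is not an open neighbourhood of [y0]. *)
  have [oU|noU] := pselect (open U); last by exists (fun=> 0).
  have [Uy0|nU] := pselect (U y0); last by exists (fun=> 0).
  have [|N [[N0 NT] Nmono Nsub Nsup Ninv]] := covering_number minY oU.
    by exists y0.
  exists (fun C => (N C)%:R / (N setT)%:R) => _ _.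
  have NT0 : 0 < (N setT)%:R^-1 :> R by rewrite invr_gt0 ltr0n.
  split.
  - by rewrite N0 mul0r mulfV// pnatr_eq0 -lt0n.
  - by move=> C D CD; rewrite ler_pM2r// ler_nat Nmono.
  - by move=> C D; rewrite -mulrDl ler_pM2r// -natrD ler_nat.
  - by move=> C D /Nsup; rewrite -mulrDl ler_pM2r// -natrD ler_nat.
  - by move=> g C; rewrite Ninv.
pose F0 : set_system (set X) := filter_from [set V | open V /\ V y0]
  (fun V => [set U | [/\ open U, U y0 & U `<=` V]]).
have FF0 : ProperFilter F0.
  apply: filter_from_proper => [|V [oV Vy0]]; last by exists V; split.
  apply: filter_from_filter => [|V W [oV Vy0] [oW Wy0]].
    by exists setT; split => //; exact: openT.
  exists (V `&` W); first by split => //; exact: openI.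
  by move=> U [oU Uy0 UVW]; split; split => // x /UVW[].
have [F [UF FF]] := ultraFilterLemma FF0.
have FP : \forall U \near F, open U /\ U y0.
  by apply: FF; exists setT; [split => //; exact: openT|move=> U []].
have /choice[lam lamP] C : exists l : R, f U C @[U --> F] --> l.
  apply: (@ultra_cvg_bounded _ _ _ _ 0 1).
  apply: filterS FP => U [oU Uy0]; have [[l0 lT] mono _ _ _] := fP U oU Uy0.
  by rewrite -l0 -lT !mono.
have le_lim (u v : set X -> R) (a b : R) : u @ F --> a -> v @ F --> b ->
    (\forall U \near F, u U <= v U) -> a <= b.
  move=> ua vb uv; rewrite -subr_ge0; apply: (cvgr_to_ge (cvgB vb ua)).
  by apply: filterS uv => U; rewrite subr_ge0.
have lamE C D : (forall U, open U -> U y0 -> f U C = f U D) -> lam C = lam D.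
  move=> CD; apply: (cvg_unique _ (lamP C)); first exact: Rhausdorff.
  apply: (cvg_trans _ (lamP D)); apply: near_eq_cvg.
  by apply: filterS FP => U [oU Uy0]; exact/esym/CD.
have lam_cst C r : (forall U, open U -> U y0 -> f U C = r) -> lam C = r.
  move=> Cr; apply: (cvg_unique _ (lamP C)); first exact: Rhausdorff.
  apply: cvg_near_cst.
  by apply: filterS FP => U [oU Uy0]; exact: Cr.
exists lam; split; last 2 first.
- by apply: lam_cst => U oU Uy0; have [[]] := fP U oU Uy0.
- by move=> g C; apply: lamE => U oU Uy0; have [_ _ _ _ ->] := fP U oU Uy0.
split.
- by apply: lam_cst => U oU Uy0; have [[]] := fP U oU Uy0.
- move=> C D _ _ CD; apply: le_lim; [exact: lamP C|exact: lamP D|].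
  by apply: filterS FP => U [oU Uy0]; have [_ + _ _ _] := fP U oU Uy0; exact.
- move=> C D _ _; apply: le_lim; [exact: lamP|exact: cvgD (lamP C) (lamP D)|].
  by apply: filterS FP => U [oU Uy0]; have [_ _ + _ _] := fP U oU Uy0; exact.
- move=> C D cC cD CD0; apply: le_lim; [exact: cvgD (lamP C) (lamP D)|exact: lamP _|].
  (* This neighbourhood depends on [C] and [D], but the ultrafilter concentrates on the [U] inside
     it. *)
  have [V [oV Vy0 nospl]] := minimal_nonsplit minY Yy0 cC cD CD0.
  apply: FF; exists V => // U [oU Uy0 UV].
  have [_ _ _ + _] := fP U oU Uy0; apply => g [[u [/UV ? ? ?]] [v [/UV ? ? ?]]].
  by apply: (nospl g); split; [exists u|exists v].
Qed.

Lemma invariant_probability (R : realType) : exists mu : probability (borel X) R,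
  forall g B, mu (act g @` B) = mu B.
Proof.
have [lam [lamP lamT laminv]] := invariant_content R.
exists (content_probability lamP cX hX lamT) => g B.
by apply: (@content_probability_invariant _ _ _ _ _ _ _ _ (act (inv g))).
Qed.

End TameFlow.

(** * Application to definable actions *)

Theorem theorem1p4 (R : realType) (L : language) (M : structure L)
    (G : definable_group M) :
  countable (Th M) -> omega1_saturated M -> weakly_definably_amenable R G.
Proof.
move=> _ satM X act cX hX defA; have [[act1 actM homeo] _] := defA.
have actK g : cancel (act g) (act (dg_inv g)).
  by move=> x; rewrite -actM dg_mulV act1.
have actVK g : cancel (act (dg_inv g)) (act g).
  (* The group axioms give a left inverse; surjectivity of [act g] makes it two-sided on [X]. *)
  move=> x; have [_ [h [_ hK _]]] := homeo g.
  by rewrite -{1}(hK x) actK hK.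
have actC g : continuous (act g) by have [] := homeo g.
have [|mu muP] := @invariant_probability X G (dg_one G) (@dg_mul _ _ G)
    (@dg_inv _ _ G) act cX hX act1 actM actK actVK actC _ R.
  by move=> x C D; exact: tame_definable_action.
by exists mu => g B _; exact: muP.
Qed.
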